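(* Let $\nabla f=[f_u,f_v]^T$ and $\mathbf{H}$ be the gradient and Hessian, at a point, of a height function $f$ of a smooth surface in an orthonormal coordinate system. Let $\ell=\sqrt{1+f_u^2+f_v^2}$, let $\hat{\mathbf{n}}=[-f_u,-f_v,1]^T/\ell$ be the unit normal, and let $\mathbf{C}=\mathbf{J}^{+T}\mathbf{H}\mathbf{J}^{+}/\ell$ be the curvature tensor, where $\mathbf{J}=[\mathbf{I}_{2\times 2}\mid\nabla f]^T$. Let $\hat{\mathbf{Q}}=[\hat{\mathbf{q}}_1\mid\hat{\mathbf{q}}_2\mid\hat{\mathbf{q}}_3]$ be an orthogonal $3\times 3$ matrix whose column vectors form the axes of another coordinate system, with $\hat{\mathbf{q}}_3^T\hat{\mathbf{n}}>0$. Let $[\alpha,\beta,\gamma]^T=\hat{\mathbf{Q}}^T\hat{\mathbf{n}}$, and let $\tilde f$ be the height function in the latter coordinate frame corresponding to the same smooth surface. Then, at the corresponding point, the gradient of $\tilde f$ is $$\nabla\tilde f=\begin{bmatrix}-\alpha/\gamma\\-\beta/\gamma\end{bmatrix},$$ and the Hessian of $\tilde f$ is $\tilde{\mathbf{J}}^T\mathbf{C}\tilde{\mathbf{J}}/\gamma$, where $\tilde{\mathbf{J}}=\hat{\mathbf{Q}}\,[\mathbf{I}_{2\times2}\mid\nabla\tilde f]^T$.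
   Context: A height function of a smooth surface in an orthonormal frame is a smooth function $f$ on an open subset of $\mathbb{R}^2$ such that, near the given point, the surface consists, in the coordinates of that frame, of the points $[u,v,f(u,v)]^T$. Here the columns $\hat{\mathbf q}_i$, $\hat{\mathbf{n}}$ and $\mathbf{C}$ are expressed in the coordinates of the first frame. $\mathbf{J}$ is a $3\times2$ matrix, $\mathbf{J}^+=(\mathbf{J}^T\mathbf{J})^{-1}\mathbf{J}^T$ is its Moore–Penrose pseudo-inverse, and $\mathbf{J}^{+T}=(\mathbf{J}^+)^T$. *)

(* Defs.v *)
From HB Require Import structures.
From mathcomp Require Import all_boot all_order all_algebra.
From mathcomp Require Import all_classical all_reals all_analysis.
Set Implicit Arguments.
Unset Strict Implicit.
Unset Printing Implicit Defensive.
Import Order.TTheory GRing.Theory Num.Theory.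
Import numFieldNormedType.Exports.
Local Open Scope classical_set_scope.
Local Open Scope ring_scope.

Definition vec2 (R : realType) (a b : R) : 'cV[R]_2 := \col_i [:: a; b]`_i.

Definition vec3 (R : realType) (a b c : R) : 'cV[R]_3 := \col_i [:: a; b; c]`_i.

Definition partial (R : realType) (i : 'I_2) (f : 'cV[R]_2 -> R) : 'cV[R]_2 -> R :=
  'D_(delta_mx i 0) f.

(* Partial derivatives of all orders exist and are continuous on [U]; the
   outermost derivative of [foldr (@partial R) f s] is the head of [s]. *)
Definition smooth_on (R : realType) (U : set 'cV[R]_2) (f : 'cV[R]_2 -> R) : Prop :=
  forall (s : seq 'I_2) (w : 'cV[R]_2), U w ->
    {for w, continuous (foldr (@partial R) f s)} /\
    forall i : 'I_2, derivable (foldr (@partial R) f s) w (delta_mx i 0).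

Definition gradient (R : realType) (f : 'cV[R]_2 -> R) (w : 'cV[R]_2) : 'cV[R]_2 :=
  \col_i partial i f w.

Definition hessian (R : realType) (f : 'cV[R]_2 -> R) (w : 'cV[R]_2) : 'M[R]_2 :=
  \matrix_(i, j) partial j (partial i f) w.

Definition graph_point (R : realType) (f : 'cV[R]_2 -> R) (w : 'cV[R]_2) : 'cV[R]_3 :=
  vec3 (w 0 0) (w 1 0) (f w).

Definition orthogonal_mx (R : realType) (n : nat) (Q : 'M[R]_n) : Prop :=
  Q^T *m Q = 1%:M.

(* A frame is given by its origin [o] and the matrix [Q] whose columns are its
   axes, so that coordinates [y] in the frame denote the point [o + Q *m y]. *)
Definition frame_point (R : realType) (o : 'cV[R]_3) (Q : 'M[R]_3) (y : 'cV[R]_3) :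
  'cV[R]_3 := o + Q *m y.

(* [f], restricted to the open set [U], is a height function of the surface [S]
   near the point [p] of [S] in the frame [(o, Q)], and [p] lies above [w].  The
   existence of such an [f] for an orthogonal [Q] is what it means for [S] to be
   a smooth surface near [p].  The values of [f] outside [U] are irrelevant. *)
Definition height_function (R : realType) (S : set 'cV[R]_3) (p : 'cV[R]_3)
    (o : 'cV[R]_3) (Q : 'M[R]_3)
    (U : set 'cV[R]_2) (f : 'cV[R]_2 -> R) (w : 'cV[R]_2) : Prop :=
  [/\ open U, smooth_on U f, U w, p = frame_point o Q (graph_point f w) &
      \forall x \near p,
        S x <-> exists2 y, U y & x = frame_point o Q (graph_point f y)].

Definition slope_length (R : realType) (g : 'cV[R]_2) : R :=
  Num.sqrt (1 + g 0 0 ^+ 2 + g 1 0 ^+ 2).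

Definition unit_normal (R : realType) (g : 'cV[R]_2) : 'cV[R]_3 :=
  (slope_length g)^-1 *: vec3 (- g 0 0) (- g 1 0) 1.

Definition tangent_mx (R : realType) (g : 'cV[R]_2) : 'M[R]_(3, 2) :=
  (row_mx (1%:M : 'M[R]_2) g)^T.

Definition pinv (R : realType) (m n : nat) (J : 'M[R]_(m, n)) : 'M[R]_(n, m) :=
  invmx (J^T *m J) *m J^T.

Definition curvature_tensor (R : realType) (g : 'cV[R]_2) (H : 'M[R]_2) : 'M[R]_3 :=
  let J := tangent_mx g in
  (slope_length g)^-1 *: ((pinv J)^T *m H *m pinv J).

(* Main.v *)
Require Import Defs.
From HB Require Import structures.
From mathcomp Require Import all_boot all_order all_algebra.
From mathcomp Require Import all_classical all_reals all_analysis.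
From mathcomp Require Import ring.
Import Order.TTheory GRing.Theory Num.Theory.
Import numFieldNormedType.Exports.
Local Open Scope classical_set_scope.
Local Open Scope ring_scope.

(* Near [w'] the graph of [f'], placed in its frame, is a map [P] whose points
   satisfy the equation [z = f (x, y)].  Differentiating this identity once says
   that the columns of [Q [I | grad f']^T] are orthogonal to [(- grad f, 1)], a
   linear equation for [grad f'] that [gamma <> 0] makes solvable; it holds
   near [w'], and differentiating it once more gives the Hessian.  Finally, such
   tangent columns are of the form [J M], with [M] their first two rows, and
   [J^+ J = 1] turns [C] back into the Hessian of [f]. *)

(** * Differential calculus in several variables *)

Lemma is_derive_line (R : numFieldType) (V W : normedModType R) (f : V -> W)
    (x e : V) (s : R) :
  derivable f (x + s *: e) e ->
  is_derive s (1 : R) (fun t : R => f (x + t *: e)) ('D_e f (x + s *: e)).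
Proof.
have E : (fun h : R => h^-1 *: (f (x + (h *: 1 + s) *: e) - f (x + s *: e))) =
    (fun h : R => h^-1 *: (f (h *: e + (x + s *: e)) - f (x + s *: e))).
  by apply/funext => h; rewrite -[h *: 1]/(h * 1) mulr1 scalerDl addrCA.
by move=> fe; split; rewrite /derivable /derive /= E.
Qed.

(** The one-variable mean value theorem along the line through [x]. As [t] may have either sign, it
    is applied on [[0, t]] or on [[t, 0]], and the bound on [s] uses absolute values. *)
Lemma mean_value_line (R : realType) (V : normedModType R) (f : V -> R)
    (x e : V) (t : R) :
  (forall s, `|s| <= `|t| -> derivable f (x + s *: e) e) ->
  exists2 s, `|s| <= `|t| & f (x + t *: e) - f x = t * 'D_e f (x + s *: e).
Proof.
move=> fe; pose F s := f (x + s *: e); pose dF s := 'D_e f (x + s *: e).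
have F0 : F 0 = f x by rewrite /F scale0r addr0.
have isF s : `|s| <= `|t| -> is_derive s (1 : R) F (dF s).
  by move=> st; apply: is_derive_line; exact: fe.
have cF a b : (forall s, s \in `[a, b]%R -> `|s| <= `|t|) ->
    {within `[a, b], continuous F}.
  move=> H; apply: derivable_within_continuous => s /H st.
  by have [] := isF _ st.
have [t0|t0] := leP 0 t.
  have H s : s \in `[0, t]%R -> `|s| <= `|t|.
    by rewrite in_itv /= => /andP[s0 st]; rewrite !ger0_norm.
  have [||s sI] := @MVT_segment R F dF 0 t t0.
  - by move=> s /subset_itv_oo_cc /H; exact: isF.
  - exact: cF.
  by rewrite F0 subr0 mulrC => Fs; exists s => //; exact: H.
have H s : s \in `[t, 0]%R -> `|s| <= `|t|.
  by rewrite in_itv /= => /andP[st s0]; rewrite !ler0_norm ?lerN2 // ltW.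
have [||s sI] := @MVT_segment R F dF t 0 (ltW t0).
- by move=> s /subset_itv_oo_cc /H; exact: isF.
- exact: cF.
rewrite F0 sub0r => Fs; exists s; first exact: H.
by rewrite -opprB Fs mulrN opprK mulrC.
Qed.

Lemma differentiable_linear_approx (R : numFieldType) (V W : normedModType R)
    (f : V -> W) (df : {linear V -> W}) (x : V) :
  continuous df -> f \o shift x = cst (f x) + df +o_ 0 id ->
  differentiable f x.
Proof.
by move=> dfc dxf; apply/diff_locallyP; rewrite (diff_unique dfc dxf).
Qed.

Lemma mx_entry_norm (R : realDomainType) m n (A : 'M[R]_(m, n)) i j :
  `|A i j| <= `|A|.
Proof.
by rewrite [leRHS]/Num.Def.normr/= mx_normrE; exact: (le_bigmax _ _ (i, j)).
Qed.

(** [smooth_on] speaks of partial derivatives only, while the chain rule needs a total differential;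
    this criterion connects them. The candidate differential is [L], built from the partial
    derivatives at [w]. *)
Lemma differentiable_partials (R : realType) n (f : 'cV[R]_n -> R)
    (w : 'cV[R]_n) :
  (forall i, \forall x \near w, derivable f x (delta_mx i 0)) ->
  (forall i, {for w, continuous ('D_(delta_mx i 0) f)}) ->
  differentiable f w.
Proof.
move=> df cf.
pose L (h : 'cV[R]_n) := \sum_i h i 0 * 'D_(delta_mx i 0) f w.
have linL : linear L.
  move=> a u v; rewrite /L scaler_sumr -big_split /=; apply: eq_bigr => i _.
  by rewrite !mxE mulrDl -mulrA.
pose LM := GRing.isLinear.Build _ _ _ _ L linL.
pose LL : {linear 'cV[R]_n -> R} := HB.pack L LM.
have cL : continuous LL.
  apply: continuous_big => [|i _]; first exact: add_continuous.
  move=> x; apply: (@continuousM _ _ (fun h : 'cV[R]_n => h i 0)).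
    exact: coord_continuous.
  exact: cst_continuous.
apply: (@differentiable_linear_approx _ _ _ f LL w cL).
apply/eqaddoP => _/posnumP[e].
(* The [n] coordinate steps will each cost [e' * |h|]; dividing by [n.+1] rather than [n] also
   covers [n = 0]. *)
pose e' := e%:num / n.+1%:R.
have e'0 : 0 < e' by rewrite divr_gt0.
have near_i i : \forall x \near w, derivable f x (delta_mx i 0) /\
    `|'D_(delta_mx i 0) f w - 'D_(delta_mx i 0) f x| <= e'.
  have /cvgrPdist_le/(_ _ e'0) ci := cf i.
  exact: filterI (df i) ci.
have near_all := @filter_forall _ _ _ _ (nbhs_filter w) near_i.
have /nbhs_ballP[d d0 Hd] := near_all.
have near0 : \forall h \near (0 : 'cV[R]_n), `|h| < d by exact: nbhs0_lt.
apply: filterS near0 => h hd.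
(* [hk] leads from [0] to [h] by changing one coordinate at a time; each step is
   estimated by the mean value theorem. *)
pose hk k : 'cV[R]_n := \col_i (if (i < k)%N then h i 0 else 0).
have hkS (i : 'I_n) : hk i.+1 = hk i + h i 0 *: delta_mx i 0.
  apply/colP => j; rewrite !mxE ltnS eqxx andbT leq_eqVlt.
  have [ji|ji] := eqVneq j i; first by rewrite ji eqxx ltnn /= mulr1 add0r.
  by rewrite (_ : (j == i :> nat) = false) ?mulr0 ?addr0 //; apply/negbTE.
have -> : (f \o shift w - (cst (f w) + LL)) h =
    \sum_(i < n) ((f (w + hk i.+1) - f (w + hk i)) -
      h i 0 * 'D_(delta_mx i 0) f w).
  rewrite sumrB -(big_mkord xpredT (fun i => f (w + hk i.+1) - f (w + hk i))).
  rewrite telescope_sumr // (_ : hk n = h); last first.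
    by apply/colP => j; rewrite !mxE ltn_ord.
  rewrite (_ : hk 0 = 0); last by apply/colP => j; rewrite !mxE.
  by rewrite addr0 -!addrA -opprD [w + h]addrC.
apply: (le_trans (ler_norm_sum _ _ _)).
apply: (@le_trans _ _ (\sum_(i < n) e' * `|h|)); last first.
  rewrite sumr_const card_ord -mulr_natr mulrAC ler_wpM2r // /e' -mulrA.
  by rewrite ler_piMr // ler_pdivrMl // mulr1 ler_nat.
apply: ler_sum => i _.
(* The norm is the maximum norm, and along the path each coordinate moves by [0], by its entry of
   [h], or by [s]; so the path stays within [|h|] of [w]. *)
have ball_step s : `|s| <= `|h i 0| ->
    ball w d (w + hk i + s *: delta_mx i 0).
  move=> sh; rewrite -ball_normE /= -addrA opprD addrA subrr add0r normrN.
  apply: le_lt_trans hd; rewrite [leLHS]/Num.Def.normr/= mx_normrE.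
  apply: bigmax_le => // -[j k] _ /=; rewrite ord1 !mxE eqxx andbT.
  have [->|ji] := eqVneq j i.
    by rewrite ltnn add0r mulr1 (le_trans sh) // mx_entry_norm.
  by rewrite mulr0 addr0; case: ifP => _; rewrite ?normr0 // mx_entry_norm.
have [s sh] : exists2 s, `|s| <= `|h i 0| & f (w + hk i.+1) - f (w + hk i) =
    h i 0 * 'D_(delta_mx i 0) f (w + hk i + s *: delta_mx i 0).
  rewrite hkS addrA; apply: mean_value_line => s sh.
  by have [] := Hd _ (ball_step _ sh) i.
move=> ->; rewrite -mulrBr normrM mulrC ler_pM ?mx_entry_norm //.
by rewrite distrC; have [] := Hd _ (ball_step _ sh) i.
Unshelve. all: by end_near. Qed.

Lemma diff_partials (R : realType) n (f : 'cV[R]_n -> R) (w h : 'cV[R]_n) :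
  differentiable f w ->
  'd f w h = \sum_i h i 0 * 'D_(delta_mx i 0) f w.
Proof.
move=> df; rewrite {1}[h]matrix_sum_delta linear_sum; apply: eq_bigr => i _.
by rewrite big_ord1 linearZ deriveE.
Qed.

Lemma derive_comp_partials (R : realType) (V : normedModType R) n
    (G : V -> 'cV[R]_n) (g : 'cV[R]_n -> R) (x e : V) :
  differentiable G x -> differentiable g (G x) ->
  is_derive x e (g \o G)
    (\sum_i 'D_e (fun y => G y i 0) x * 'D_(delta_mx i 0) g (G x)).
Proof.
move=> dG dg; have dgG := differentiable_comp dG dg.
split; first exact: diff_derivable.
rewrite deriveE // (diff_comp dG dg) /= -(deriveE e dG) diff_partials //.
rewrite derive_mx; last exact: diff_derivable.
by apply: eq_bigr => i _; rewrite mxE.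
Qed.

(** A matrix is the sum of its entries times constant matrices, which reduces the claim to sums and
    scalings. *)
Lemma differentiable_mx (R : realType) (V : normedModType R) m n
    (M : V -> 'M[R]_(m, n)) (x : V) :
  (forall i j, differentiable (fun y => M y i j) x) -> differentiable M x.
Proof.
move=> dM.
have -> : M = (\sum_i \sum_j fun y => M y i j *: delta_mx i j).
  apply/funext => y; rewrite {1}[M y]matrix_sum_delta fct_sumE.
  by apply: eq_bigr => i _; rewrite fct_sumE.
by do 2![apply: differentiable_sum => ?]; exact: differentiableZl.
Qed.

Lemma is_derive_coord (R : realType) n (x e : 'cV[R]_n) i :
  is_derive x e (fun y : 'cV[R]_n => y i 0) (e i 0).
Proof.
split; first exact/diff_derivable/differentiable_coord.
have := @derive_mx _ _ _ _ (@id 'cV[R]_n) x e (@derivable_id _ _ _ _).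
by rewrite derive_id => /matrixP/(_ i 0); rewrite mxE => ->.
Qed.

(** Reads ['I_3] as [2 + 1]: [top] embeds the two horizontal indices, and [ord_max] is the vertical
    one. *)
Local Notation top := (@lshift 2 1).

(** The partial derivatives of the iterated derivative indexed by [s] are those indexed by [i :: s],
    again continuous on [U]. *)
Lemma smooth_on_differentiable (R : realType) (U : set 'cV[R]_2)
    (f : 'cV[R]_2 -> R) (s : seq 'I_2) (w : 'cV[R]_2) :
  open U -> smooth_on U f -> U w -> differentiable (foldr (@partial R) f s) w.
Proof.
move=> oU sf Uw; apply: differentiable_partials => i.
  have nU : \forall x \near w, U x by exact: open_nbhs_nbhs.
  by apply: filterS nU => x Ux; exact: (sf s x Ux).2.
exact: (sf (i :: s) w Uw).1.
Qed.

(** * The graph parametrization in an arbitrary frame and its tangent vectors *)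

Section frame_graph.
Variables (R : realType) (o : 'cV[R]_3) (Q : 'M[R]_3) (f : 'cV[R]_2 -> R).

Lemma frame_graphE (k : 'I_3) :
  (fun v => frame_point o Q (graph_point f v) k 0) =
  (fun v => o k 0 + Q k 0 * v 0 0 + Q k 1 * v 1 0 + Q k ord_max * f v).
Proof.
apply/funext => v; rewrite /frame_point !mxE !big_ord_recl big_ord0 !mxE /=.
rewrite addr0 !addrA.
by congr (_ + Q _ _ * _ + Q _ _ * _ + Q _ _ * _); do ?exact: val_inj.
Qed.

Lemma differentiable_frame_graph (v : 'cV[R]_2) :
  differentiable f v ->
  differentiable (fun u => frame_point o Q (graph_point f u)) v.
Proof.
move=> df; apply: differentiable_mx => k j; rewrite (ord1 j) frame_graphE.
have dc i := differentiable_coord v i 0.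
apply: differentiableD; last exact: differentiableM.
apply: differentiableD; last exact: differentiableM.
by apply: differentiableD => //; exact: differentiableM.
Qed.

Lemma frame_tangentE (v : 'cV[R]_2) (k : 'I_3) (j : 'I_2) :
  (Q *m tangent_mx (gradient f v)) k j =
  Q k 0 * (j == 0)%:R + Q k 1 * (j == 1)%:R + Q k ord_max * partial j f v.
Proof.
rewrite mxE (@big_split_ord _ _ _ 2 1) /= big_ord1 big_ord_recl big_ord1.
rewrite ![tangent_mx _ _ _]mxE !row_mxEl row_mxEr !mxE.
by congr (Q _ _ * _ + Q _ _ * _ + Q _ _ * _); exact: val_inj.
Qed.

Lemma is_derive_frame_graph (v : 'cV[R]_2) (k : 'I_3) (j : 'I_2) :
  differentiable f v ->
  is_derive v (delta_mx j 0) (fun u => frame_point o Q (graph_point f u) k 0)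
    ((Q *m tangent_mx (gradient f v)) k j).
Proof.
move=> df; rewrite frame_graphE frame_tangentE.
have d0 := is_derive_coord _ _ v (delta_mx j 0) 0.
have d1 := is_derive_coord _ _ v (delta_mx j 0) 1.
have d2 : is_derive v (delta_mx j 0) f (partial j f v).
  by split => //; exact: diff_derivable.
have -> : (fun u : 'cV[R]_2 =>
      o k 0 + Q k 0 * u 0 0 + Q k 1 * u 1 0 + Q k ord_max * f u) =
    cst (o k 0) + Q k 0 *: (fun u : 'cV[R]_2 => u 0 0) +
    Q k 1 *: (fun u : 'cV[R]_2 => u 1 0) + Q k ord_max *: f by [].
by apply: is_derive_eq; rewrite add0r !mxE !andbT ![_ == j]eq_sym.
Qed.
End frame_graph.

(** * Pseudo-inverse and curvature tensor on tangent vectors *)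

Lemma det_mx2 (R : comPzRingType) (A : 'M[R]_2) :
  \det A = A 0 0 * A 1 1 - A 0 1 * A 1 0.
Proof.
rewrite (expand_det_row _ 0) big_ord_recl big_ord1 /cofactor !det_mx11 !mxE /=.
rewrite expr0 expr1 mul1r mulN1r mulrN.
by congr (_ * A _ _ - A _ _ * A _ _); exact: val_inj.
Qed.

(** The Gram matrix is [1 + g *m g^T], whose determinant [1 + g_0^2 + g_1^2] is positive, so the
    inverse in [pinv] is a true one. *)
Lemma pinv_tangent_mx (R : realType) (g : 'cV[R]_2) :
  Defs.pinv (tangent_mx g) *m tangent_mx g = 1%:M.
Proof.
rewrite /Defs.pinv -mulmxA mulVmx // unitmxE det_mx2 unitfE.
have E i j : ((tangent_mx g)^T *m tangent_mx g) i j =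
    (i == j)%:R + g i 0 * g j 0.
  have T k l : tangent_mx g k l = row_mx 1%:M g l k by rewrite mxE.
  have T' k l : (tangent_mx g)^T k l = row_mx 1%:M g k l by rewrite mxE T.
  rewrite mxE (@big_split_ord _ _ _ 2 1) /= big_ord1.
  rewrite T' T !row_mxEr; congr (_ + _).
  rewrite (bigD1 i) //= big1 ?addr0 => [|k ki].
    by rewrite T' T !row_mxEl !mxE eqxx mul1r eq_sym.
  by rewrite T' row_mxEl mxE eq_sym (negbTE ki) mul0r.
rewrite !E /= mulr0n mulr1n lt0r_neq0 //.
rewrite (_ : _ - _ = 1 + g 0 0 ^+ 2 + g 1 0 ^+ 2); last by ring.
by rewrite -addrA ltr_pwDl ?addr_ge0 ?sqr_ge0.
Qed.

Lemma curvature_tensor_tangent (R : realType) (g : 'cV[R]_2) (H : 'M[R]_2)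
    n (M : 'M[R]_(2, n)) :
  let J' := tangent_mx g *m M in
  J'^T *m curvature_tensor g H *m J' = (slope_length g)^-1 *: (M^T *m H *m M).
Proof.
have := congr1 (mulmx^~ M) (pinv_tangent_mx _ g); rewrite mul1mx -mulmxA.
rewrite /curvature_tensor; move: (Defs.pinv _) => K pJ /=.
rewrite -scalemxAr -scalemxAl; congr (_ *: _).
by rewrite !mulmxA -trmx_mul -!mulmxA pJ.
Qed.

(** * Comparison of the two height functions to first and second order *)

Lemma height_functions_near (R : realType) (S : set 'cV[R]_3) (p : 'cV[R]_3)
    (U : set 'cV[R]_2) (f : 'cV[R]_2 -> R) (w : 'cV[R]_2)
    (o : 'cV[R]_3) (Q : 'M[R]_3)
    (U' : set 'cV[R]_2) (f' : 'cV[R]_2 -> R) (w' : 'cV[R]_2) :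
  height_function S p 0 1%:M U f w -> height_function S p o Q U' f' w' ->
  \forall v \near w', U' v /\
    exists2 y, U y & frame_point o Q (graph_point f' v) = graph_point f y.
Proof.
move=> [oU sf Uw pw nS] [oU' sf' Uw' pw' nS'].
have nU' : \forall v \near w', U' v by exact: open_nbhs_nbhs.
(* By continuity, the point above [v] stays where both descriptions of [S] are valid; the one by
   [f'] puts it on [S], and the one by [f] then supplies [y]. *)
have cP : {for w', continuous (fun v => frame_point o Q (graph_point f' v))}.
  apply/differentiable_continuous/differentiable_frame_graph.
  exact: (@smooth_on_differentiable _ _ _ [::] _ oU' sf' Uw').
have nSS : \forall x \near p,
    (S x <-> exists2 y, U y & x = frame_point 0 1%:M (graph_point f y)) /\
    (S x <-> exists2 y, U' y & x = frame_point o Q (graph_point f' y)).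
  exact: filterI nS nS'.
rewrite pw' in nSS; have nP := cP _ nSS.
apply: filterS2 nU' nP => v Uv [fS fS']; split => //.
have /fS[y Uy xy] : S (frame_point o Q (graph_point f' v)).
  by apply/fS'; exists v.
by exists y => //; rewrite xy /frame_point mul1mx add0r.
Qed.

Section frame_change.
Variables (R : realType) (o : 'cV[R]_3) (Q : 'M[R]_3).
Variables (f f' : 'cV[R]_2 -> R).

Let P v := frame_point o Q (graph_point f' v).
Let T v := Q *m tangent_mx (gradient f' v).
(* The shadow of [P v], that is, its projection to the domain of [f]. *)
Let G v : 'cV[R]_2 := \col_i P v (top i) 0.

Lemma differentiable_shadow v : differentiable f' v -> differentiable G v.
Proof.
move=> df'; apply: differentiable_mx => i j.
rewrite (_ : (fun v => _) = fun v => P v (top i) 0).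
  apply: (differentiable_comp (g := fun M : 'cV[R]_3 => M (top i) 0)).
    exact: differentiable_frame_graph.
  exact: differentiable_coord.
by apply/funext => u; rewrite mxE.
Qed.

(** Chain rule, where the Jacobian of [G] is formed by the first two rows of [T]. *)
Lemma is_derive_shadow_comp (g : 'cV[R]_2 -> R) v j :
  differentiable f' v -> differentiable g (G v) ->
  is_derive v (delta_mx j 0) (g \o G)
    (\sum_i T v (top i) j * partial i g (G v)).
Proof.
move=> df' dg.
have dG := differentiable_shadow _ df'.
apply: is_derive_eq (derive_comp_partials _ _ _ _ _ _ _ dG dg) _.
apply: eq_bigr => i _; congr (_ * _).
rewrite (_ : (fun y => _) = fun v => P v (top i) 0).
  by have [_ ->] := is_derive_frame_graph _ o Q _ _ (top i) j df'.
by apply/funext => u; rewrite mxE.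
Qed.

Lemma tangent_shadow v j :
  (\forall u \near v, P u ord_max 0 = f (G u)) ->
  differentiable f' v -> differentiable f (G v) ->
  T v ord_max j = \sum_i T v (top i) j * partial i f (G v).
Proof.
move=> PG df' df.
have [_ <-] := is_derive_frame_graph _ o Q _ _ ord_max j df'.
have [_ <-] := is_derive_shadow_comp _ _ j df' df.
exact: near_eq_derive PG.
Qed.

Lemma is_derive_tangent v k i j :
  differentiable (partial j f') v ->
  is_derive v (delta_mx i 0) (fun u => T u k j)
    (Q k ord_max * partial i (partial j f') v).
Proof.
move=> dj; have d2 : is_derive v (delta_mx i 0) (partial j f')
    (partial i (partial j f') v).
  by split => //; exact: diff_derivable.
rewrite (_ : (fun u => _) = cst (Q k 0 * (j == 0)%:R + Q k 1 * (j == 1)%:R) +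
    Q k ord_max *: partial j f').
  by apply: is_derive_eq; rewrite add0r.
by apply/funext => u; rewrite /T frame_tangentE.
Qed.

(** Differentiate the tangency relation. The second derivative of [f'] enters through every entry of
    [T]; collecting its terms on the left leaves as coefficient the inner product of the third axis
    with [(- grad f, 1)]. *)
Lemma second_derivative_shadow v i j :
  (\forall u \near v,
    T u ord_max j = \sum_k T u (top k) j * partial k f (G u)) ->
  differentiable f' v -> differentiable (partial j f') v ->
  (forall k, differentiable (partial k f) (G v)) ->
  (Q ord_max ord_max - \sum_k Q (top k) ord_max * partial k f (G v)) *
    partial i (partial j f') v =
  \sum_k T v (top k) j *
    \sum_l T v (top l) i * partial l (partial k f) (G v).
Proof.
move=> TG df' dj dk.
have d1 k := is_derive_tangent v k i j dj.
have d2 k := is_derive_shadow_comp _ v i df' (dk k).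
have dsum : is_derive v (delta_mx i 0)
    (fun u => \sum_k T u (top k) j * partial k f (G u))
    (\sum_k (T v (top k) j *
       (\sum_l T v (top l) i * partial l (partial k f) (G v)) +
      partial k f (G v) * (Q (top k) ord_max * partial i (partial j f') v))).
  rewrite (_ : (fun u => _) =
      \sum_k ((fun u => T u (top k) j) * (partial k f \o G))).
    apply: is_derive_sum => k; have := d1 (top k); have := d2 k => ? ?.
    exact: is_derive_eq.
  by apply/funext => u; rewrite fct_sumE.
have := near_eq_derive (delta_mx i 0) TG.
have [_ ->] := d1 ord_max; have [_ ->] := dsum.
rewrite big_split /= mulrBl mulr_suml => ->; apply/eqP.
rewrite subr_eq; apply/eqP; congr (_ + _); apply: eq_bigr => k _.
by rewrite mulrCA mulrA.
Qed.
End frame_change.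

(** * Coordinates of the normal and of tangent vectors *)

Lemma unit_normal_shadow (R : realType) (g : 'cV[R]_2) (i : 'I_2) :
  unit_normal g (top i) 0 = - ((slope_length g)^-1 * g i 0).
Proof.
rewrite !mxE -mulrN; congr (_ * _); case: i => [[|[|]]] //= h;
  by congr (- g _ _); exact: val_inj.
Qed.

Lemma unit_normal_max (R : realType) (g : 'cV[R]_2) :
  unit_normal g ord_max 0 = (slope_length g)^-1.
Proof. by rewrite !mxE mulr1. Qed.

(** The top block of [tangent_mx g] is the identity, so a tangent column has its own first two
    entries as coefficients. *)
Lemma tangent_mx_factor (R : realType) (g : 'cV[R]_2) n (A : 'M[R]_(3, n)) :
  (forall j, A ord_max j = \sum_i A (top i) j * g i 0) ->
  A = tangent_mx g *m (\matrix_(i, j) A (top i) j).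
Proof.
move=> Amax; apply/matrixP => k j; rewrite mxE.
case: (@splitP 2 1 k) => [i|i] ki.
  have -> : k = top i by exact: val_inj.
  rewrite (bigD1 i) //= big1 ?addr0 => [|l li].
    by rewrite [tangent_mx _ _ _]mxE row_mxEl !mxE eqxx mul1r.
  by rewrite [tangent_mx _ _ _]mxE row_mxEl !mxE (negbTE li) mul0r.
have -> : k = @rshift 2 1 0 by apply: val_inj; rewrite /= ki ord1.
rewrite (_ : rshift 2 0 = ord_max) ?Amax; last exact: val_inj.
apply: eq_bigr => l _; rewrite [tangent_mx _ _ _]mxE mulrC.
rewrite (_ : ord_max = @rshift 2 1 0) ?row_mxEr ?mxE //; exact: val_inj.
Qed.

Lemma shadow_graph (R : realType) (f : 'cV[R]_2 -> R) (y : 'cV[R]_2) :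
  \col_i graph_point f y (top i) 0 = y.
Proof.
apply/colP => i; rewrite !mxE; case: i => [[|[|]]] //= h;
  by congr (y _ _); exact: val_inj.
Qed.

Theorem corollary1 (R : realType) (S : set 'cV[R]_3) (p : 'cV[R]_3)
    (U : set 'cV[R]_2) (f : 'cV[R]_2 -> R) (w : 'cV[R]_2)
    (o : 'cV[R]_3) (Q : 'M[R]_3)
    (U' : set 'cV[R]_2) (f' : 'cV[R]_2 -> R) (w' : 'cV[R]_2)
    (alpha beta gamma : R) :
  let n := unit_normal (gradient f w) in
  let C := curvature_tensor (gradient f w) (hessian f w) in
  let J' := Q *m tangent_mx (gradient f' w') in
  height_function S p 0 1%:M U f w ->
  orthogonal_mx Q ->
  0 < ((col ord_max Q)^T *m n) 0 0 ->
  vec3 alpha beta gamma = Q^T *m n ->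
  height_function S p o Q U' f' w' ->
  gradient f' w' = vec2 (- alpha / gamma) (- beta / gamma) /\
  hessian f' w' = gamma^-1 *: (J'^T *m C *m J').
Proof.
move=> n C J' Hf _ gamma_gt0 abg Hf'.
have near_graph := height_functions_near _ _ _ _ _ _ _ _ _ _ _ Hf Hf'.
have [oU sf Uw pw _] := Hf; have [oU' sf' Uw' pw' _] := Hf'.
pose G v : 'cV[R]_2 := \col_i frame_point o Q (graph_point f' v) (top i) 0.
pose T v := Q *m tangent_mx (gradient f' v).
have Gw : G w' = w.
  by rewrite /G -pw' pw /frame_point mul1mx add0r shadow_graph.
have df := @smooth_on_differentiable _ _ _ _ _ oU sf.
have df' := @smooth_on_differentiable _ _ _ _ _ oU' sf'.
have nPG : \forall v \near w', [/\ U' v, U (G v) &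
    frame_point o Q (graph_point f' v) ord_max 0 = f (G v)].
  apply: filterS near_graph => v [Uv [y Uy Py]].
  by rewrite /G Py shadow_graph mxE.
have nT j : \forall v \near w', T v ord_max j =
    \sum_i T v (top i) j * partial i f (G v).
  (* [near_join] makes the graph equation hold near each [v] close to [w'], so the tangency relation
     holds on a neighbourhood and can be differentiated again. *)
  apply: filterS (near_join nPG) => v nv; have [Uv UGv _] := nbhs_singleton nv.
  apply: tangent_shadow; last 2 first.
  - exact: (df' [::]).
  - exact: (df [::]).
  by apply: filterS nv => u [].
have T0 j := nbhs_singleton (nT j).
have H2 i j : (Q ord_max ord_max -
      \sum_k Q (top k) ord_max * partial k f w) * partial i (partial j f') w' =
  \sum_k T w' (top k) j *
    \sum_l T w' (top l) i * partial l (partial k f) w.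
  rewrite -Gw; apply: second_derivative_shadow.
  - exact: nT.
  - exact: (df' [::]).
  - exact: (df' [:: j]).
  - by move=> k; rewrite -/(G w') Gw; exact: (df [:: k]).
set L := slope_length (gradient f w).
(* For [k = ord_max] the bracket is the coefficient in [H2], named [D] below; hence [D = L * gamma],
   which is nonzero. *)
have QN k : (Q^T *m n) k 0 = L^-1 *
   (Q ord_max k - \sum_i Q (top i) k * partial i f w).
  rewrite mxE (@big_split_ord _ _ _ 2 1) /= big_ord1.
  rewrite mulrBr addrC mulr_sumr -sumrN.
  rewrite (_ : rshift 2 0 = ord_max); last exact: val_inj.
  rewrite unit_normal_max mxE mulrC; congr (_ + _).
  apply: eq_bigr => i _; rewrite unit_normal_shadow !mxE mulrN mulrCA.
  by rewrite -/L.
have L_gt0 : 0 < L.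
  by rewrite /L /slope_length sqrtr_gt0 -addrA ltr_pwDl ?addr_ge0 ?sqr_ge0.
have gammaE : gamma = (Q^T *m n) ord_max 0 by rewrite -abg mxE.
have gamma0 : gamma != 0.
  rewrite gammaE gt_eqF // (lt_le_trans gamma_gt0) // mxE [leRHS]mxE.
  by apply: ler_sum => k _; rewrite !mxE.
move: gammaE; rewrite QN; set D := (_ - _) => gammaE.
have DE : D = L * gamma by rewrite gammaE mulVKf // gt_eqF.
have TE k j : T w' k j = Q k (top j) + Q k ord_max * partial j f' w'.
  rewrite /T frame_tangentE; congr (_ + _).
  case: j => [[|[|]]] //= h; rewrite ?mulr1 ?mulr0 ?addr0 ?add0r;
    by congr (Q _ _); exact: val_inj.
have grad j : partial j f' w' = - (Q^T *m n) (top j) 0 / gamma.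
  (* Tangency is a linear equation in [partial j f' w'] with coefficient [D]; clearing the
     denominators [gamma] and [L] turns the claim into this equation. *)
  have := T0 j; rewrite TE Gw.
  under eq_bigr do rewrite TE mulrDl mulrAC.
  rewrite big_split /= -mulr_suml => Tj.
  apply: (mulIf gamma0); rewrite divfK // QN.
  apply: (mulfI (lt0r_neq0 L_gt0)); rewrite mulrN mulVKf ?gt_eqF //.
  rewrite mulrCA -DE /D.
  move/(canRL (addrK _)) : Tj => ->; ring.
split.
  apply/colP => i; rewrite mxE grad -abg !mxE.
  by case: i => [[|[|]]].
have -> : J' = tangent_mx (gradient f w) *m (\matrix_(i, j) J' (top i) j).
  apply: tangent_mx_factor => j; rewrite -/(T w') T0 Gw.
  by apply: eq_bigr => i _; rewrite [gradient f w i 0]mxE.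
rewrite curvature_tensor_tangent; apply/matrixP => i j.
rewrite mxE; apply: (mulfI (_ : D != 0)).
  by rewrite DE mulf_neq0 // gt_eqF.
(* [H2] is used with [i] and [j] interchanged, since entry [(i, j)] of the Hessian is
   [partial j (partial i f')]. The factor [D] cancels both [gamma^-1] and the [L^-1] of the
   curvature tensor. *)
rewrite H2 DE !mxE -/L -mulrA [gamma * _]mulVKf // mulVKf ?gt_eqF //.
under eq_bigr do rewrite mulr_sumr.
rewrite exchange_big; apply: eq_bigr => l _.
rewrite ![(\matrix_(_, _) _) _ _]mxE [(_ *m hessian f w) _ _]mxE mulr_suml.
apply: eq_bigr => k _; rewrite [_^T _ _]mxE [hessian _ _ _ _]mxE.
by rewrite ![(\matrix_(_, _) _) _ _]mxE mulrA mulrAC.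
Qed.
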